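(* A fusion subcategory of a fusion category is rigid.
   Context: Work over an algebraically closed field $k$ of characteristic $0$. A tensor category is a $k$-linear (additive) category with a monoidal structure whose tensor product is bilinear on morphisms. A fusion category is a $k$-linear semisimple rigid tensor category with finitely many isomorphism classes of simple objects, finite-dimensional Hom spaces and simple unit object. Here a fusion subcategory of a fusion category $\mathcal{C}$ is defined without assuming rigidity: it is a full tensor subcategory $\mathcal{D}\subset\mathcal{C}$ such that if $X\in\mathcal{C}$ is isomorphic to a direct summand of an object of $\mathcal{D}$ then $X\in\mathcal{D}$. *)

(* Defs.v *)
From mathcomp Require Import all_boot all_algebra.

Set Implicit Arguments.
Unset Strict Implicit.
Unset Printing Implicit Defensive.

Import GRing.Theory.
Local Open Scope ring_scope.

Reserved Notation "g \oc f" (at level 39, left associativity).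
Reserved Notation "X \ot Y" (at level 38, left associativity).
Reserved Notation "f \otm g" (at level 38, left associativity).

Record preLinCat (k : fieldType) := PreLinCat {
  obj :> Type;
  hom : obj -> obj -> lmodType k;
  idm : forall X, hom X X;
  cmp : forall X Y Z, hom Y Z -> hom X Y -> hom X Z;
  cmp1m : forall X Y (f : hom X Y), cmp (idm Y) f = f;
  cmpm1 : forall X Y (f : hom X Y), cmp f (idm X) = f;
  cmpA : forall X Y Z W (h : hom Z W) (g : hom Y Z) (f : hom X Y),
    cmp h (cmp g f) = cmp (cmp h g) f;
  cmp_linearr : forall X Y Z (g : hom Y Z), linear (fun f : hom X Y => cmp g f);
  cmp_linearl : forall X Y Z (f : hom X Y), linear (fun g : hom Y Z => cmp g f) }.

Arguments hom {k p} X Y : rename.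
Arguments idm {k p} X : rename.
Arguments cmp {k p X Y Z} g f : rename.

Notation "g \oc f" := (cmp g f) : ring_scope.

Section LinearCategories.
Variables (k : fieldType) (C : preLinCat k).
Implicit Types X Y Z : C.

Definition is_iso X Y (f : hom X Y) : Prop :=
  exists g : hom Y X, g \oc f = idm X /\ f \oc g = idm Y.

Definition isomorphic X Y : Prop := exists f : hom X Y, is_iso f.

Definition zero_object Z : Prop :=
  (forall X (f : hom X Z), f = 0) /\ (forall X (f : hom Z X), f = 0).

(* The empty family is allowed: its direct sums are the zero objects. *)
Definition is_direct_sum (I : finType) (S : I -> C) X : Prop :=
  exists (i : forall a, hom (S a) X) (p : forall a, hom X (S a)),
    [/\ forall a, p a \oc i a = idm (S a),
        forall a b, a <> b -> p b \oc i a = 0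
      & \sum_(a : I) i a \oc p a = idm X].

Definition direct_summand Y X : Prop :=
  exists Z, is_direct_sum (fun b : bool => if b then Y else Z) X.

Definition additive_cat : Prop :=
  forall (n : nat) (S : 'I_n -> C), exists X, is_direct_sum S X.

Definition mono X Y (f : hom X Y) : Prop :=
  forall Z (g h : hom Z X), f \oc g = f \oc h -> g = h.

Definition epi X Y (f : hom X Y) : Prop :=
  forall Z (g h : hom Y Z), g \oc f = h \oc f -> g = h.

Definition is_kernel X Y K (f : hom X Y) (i : hom K X) : Prop :=
  f \oc i = 0 /\
  forall Z (g : hom Z X), f \oc g = 0 -> exists! h : hom Z K, i \oc h = g.

Definition is_cokernel X Y Q (f : hom X Y) (q : hom Y Q) : Prop :=
  q \oc f = 0 /\
  forall Z (g : hom Y Z), g \oc f = 0 -> exists! h : hom Q Z, h \oc q = g.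

Definition abelian_cat : Prop :=
  [/\ additive_cat,
      forall X Y (f : hom X Y), exists K (i : hom K X), is_kernel f i,
      forall X Y (f : hom X Y), exists Q (q : hom Y Q), is_cokernel f q,
      forall X Y (f : hom X Y), mono f ->
        exists Z (g : hom Y Z), is_kernel g f
    & forall X Y (f : hom X Y), epi f ->
        exists Z (g : hom Z X), is_cokernel g f].

Definition simple_object X : Prop :=
  ~ zero_object X /\
  forall Y (f : hom Y X), mono f -> zero_object Y \/ is_iso f.

Definition semisimple_cat : Prop :=
  abelian_cat /\
  forall X, exists (n : nat) (S : 'I_n -> C),
    (forall a, simple_object (S a)) /\ is_direct_sum S X.

Definition finitely_many_simples : Prop :=
  exists (n : nat) (S : 'I_n -> C),
    forall X, simple_object X -> exists a, isomorphic X (S a).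

Definition finite_dim_homs : Prop :=
  forall X Y, exists (n : nat) (f : {linear hom X Y -> 'rV[k]_n}), bijective f.

End LinearCategories.

Record tensorCat (k : fieldType) := TensorCat {
  carrier :> preLinCat k;
  tc_additive : additive_cat carrier;
  unitob : carrier;
  tens : carrier -> carrier -> carrier;
  tensm : forall X X' Y Y' : carrier,
    hom X X' -> hom Y Y' -> hom (tens X Y) (tens X' Y');
  tensm_id : forall X Y, tensm (idm X) (idm Y) = idm (tens X Y);
  tensm_cmp : forall X X' X'' Y Y' Y'' (f' : hom X' X'') (f : hom X X')
      (g' : hom Y' Y'') (g : hom Y Y'),
    tensm (f' \oc f) (g' \oc g) = tensm f' g' \oc tensm f g;
  tensm_linearr : forall X X' Y Y' (f : hom X X'),
    linear (fun g : hom Y Y' => tensm f g);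
  tensm_linearl : forall X X' Y Y' (g : hom Y Y'),
    linear (fun f : hom X X' => tensm f g);
  assoc : forall X Y Z, hom (tens (tens X Y) Z) (tens X (tens Y Z));
  assocV : forall X Y Z, hom (tens X (tens Y Z)) (tens (tens X Y) Z);
  assocK : forall X Y Z, assocV X Y Z \oc assoc X Y Z = idm _;
  assocVK : forall X Y Z, assoc X Y Z \oc assocV X Y Z = idm _;
  assoc_nat : forall X X' Y Y' Z Z' (f : hom X X') (g : hom Y Y') (h : hom Z Z'),
    assoc X' Y' Z' \oc tensm (tensm f g) h
    = tensm f (tensm g h) \oc assoc X Y Z;
  lunit : forall X, hom (tens unitob X) X;
  lunitV : forall X, hom X (tens unitob X);
  lunitK : forall X, lunitV X \oc lunit X = idm _;
  lunitVK : forall X, lunit X \oc lunitV X = idm _;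
  lunit_nat : forall X Y (f : hom X Y),
    lunit Y \oc tensm (idm unitob) f = f \oc lunit X;
  runit : forall X, hom (tens X unitob) X;
  runitV : forall X, hom X (tens X unitob);
  runitK : forall X, runitV X \oc runit X = idm _;
  runitVK : forall X, runit X \oc runitV X = idm _;
  runit_nat : forall X Y (f : hom X Y),
    runit Y \oc tensm f (idm unitob) = f \oc runit X;
  pentagon : forall X Y Z W,
    assoc X Y (tens Z W) \oc assoc (tens X Y) Z W
    = tensm (idm X) (assoc Y Z W)
      \oc assoc X (tens Y Z) W \oc tensm (assoc X Y Z) (idm W);
  triangle : forall X Y,
    tensm (idm X) (lunit Y) \oc assoc X unitob Y = tensm (runit X) (idm Y) }.

Arguments unitob {k t} : rename.
Arguments tens {k t} X Y : rename.
Arguments tensm {k t X X' Y Y'} f g : rename.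
Arguments assoc {k t} X Y Z : rename.
Arguments assocV {k t} X Y Z : rename.
Arguments lunit {k t} X : rename.
Arguments lunitV {k t} X : rename.
Arguments runit {k t} X : rename.
Arguments runitV {k t} X : rename.

Notation "X \ot Y" := (tens X Y) : ring_scope.
Notation "f \otm g" := (tensm f g) : ring_scope.

Section TensorCategories.
Variables (k : fieldType) (C : tensorCat k).

(* Y is a left dual of X; equivalently, X is a right dual of Y. *)
Definition left_dual (X Y : C) : Prop :=
  exists (ev : hom (Y \ot X) unitob) (coev : hom unitob (X \ot Y)),
    runit X \oc (idm X \otm ev) \oc assoc X Y X
      \oc (coev \otm idm X) \oc lunitV X = idm X /\
    lunit Y \oc (ev \otm idm Y) \oc assocV Y X Y
      \oc (idm Y \otm coev) \oc runitV Y = idm Y.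

Definition rigid : Prop :=
  forall X : C, (exists Y, left_dual X Y) /\ (exists Y, left_dual Y X).

Record fusion_cat : Prop := FusionCat {
  fc_semisimple : semisimple_cat C;
  fc_rigid : rigid;
  fc_finite : finitely_many_simples C;
  fc_findim : finite_dim_homs C;
  fc_unit : simple_object (unitob : C) }.

(* The objects D span a full subcategory which is a tensor category for the
   operations of C; in particular it is additive. *)
Record full_tensor_subcat (D : C -> Prop) : Prop := FullTensorSubcat {
  fts_sum : forall (n : nat) (S : 'I_n -> C), (forall a, D (S a)) ->
    exists2 X, D X & is_direct_sum S X;
  fts_unit : D unitob;
  fts_tens : forall X Y, D X -> D Y -> D (X \ot Y) }.

Record fusion_subcat (D : C -> Prop) : Prop := FusionSubcat {
  fs_tensor : full_tensor_subcat D;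
  fs_summand : forall X Z Y,
    D Y -> direct_summand Z Y -> isomorphic X Z -> D X }.

Variables (D : C -> Prop) (tD : full_tensor_subcat D).

Definition full_lin : preLinCat k :=
  @PreLinCat k {X : C | D X}
    (fun X Y => hom (sval X) (sval Y)) (fun X => idm (sval X))
    (fun _ _ _ g f => g \oc f)
    (fun _ _ => @cmp1m k C _ _) (fun _ _ => @cmpm1 k C _ _)
    (fun _ _ _ _ => @cmpA k C _ _ _ _)
    (fun _ _ _ => @cmp_linearr k C _ _ _)
    (fun _ _ _ => @cmp_linearl k C _ _ _).

Lemma full_additive : additive_cat full_lin.
Proof.
move=> n S; have [X DX [i [p ip]]] := fts_sum tD (fun a => svalP (S a)).
by exists (exist _ X DX), i, p.
Qed.

Definition full_tensor : tensorCat k :=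
  @TensorCat k full_lin full_additive
    (exist _ unitob (fts_unit tD))
    (fun X Y => exist _ (sval X \ot sval Y) (fts_tens tD (svalP X) (svalP Y)))
    (fun _ _ _ _ f g => f \otm g)
    (fun _ _ => @tensm_id k C _ _)
    (fun _ _ _ _ _ _ => @tensm_cmp k C _ _ _ _ _ _)
    (fun _ _ _ _ => @tensm_linearr k C _ _ _ _)
    (fun _ _ _ _ => @tensm_linearl k C _ _ _ _)
    (fun X Y Z => assoc (sval X) (sval Y) (sval Z))
    (fun X Y Z => assocV (sval X) (sval Y) (sval Z))
    (fun _ _ _ => @assocK k C _ _ _)
    (fun _ _ _ => @assocVK k C _ _ _)
    (fun _ _ _ _ _ _ => @assoc_nat k C _ _ _ _ _ _)
    (fun X => lunit (sval X)) (fun X => lunitV (sval X))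
    (fun _ => @lunitK k C _) (fun _ => @lunitVK k C _)
    (fun _ _ => @lunit_nat k C _ _)
    (fun X => runit (sval X)) (fun X => runitV (sval X))
    (fun _ => @runitK k C _) (fun _ => @runitVK k C _)
    (fun _ _ => @runit_nat k C _ _)
    (fun _ _ _ _ => @pentagon k C _ _ _ _)
    (fun _ _ => @triangle k C _ _).

End TensorCategories.

(* Main.v *)
Require Import Defs.
From mathcomp Require Import all_boot all_order all_algebra.
From mathcomp Require Import boolp.
From mathcomp Require Import ring.
(* Gives hom back its categorical meaning, which the name of the type of linear
   maps between vector spaces would otherwise hide. *)
Import Defs.

(** A subcategory D closed under tensor products and summands is closed under
    duals because of a positivity property of the Grothendieck ring, similar to
    the fact that a finite subsemigroup of a group is a subgroup.

    Let V be simple with right dual U, so that Hom(V (x) A, B) = Hom(A, U (x) B).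
    If the unit occurs in some power U^(n+1), then Hom(V, U^n) is nonzero, V is a
    summand of U^n, and U in D forces V in D ([dual_in_subcat]).  Everything thus
    rests on the claim that the unit occurs in a positive power of U
    ([dual_in_powers]).

    Write T_0, ..., T_(m-1) for the simple objects.  Left multiplication by U
    and right multiplications by the T_b act on the Grothendieck group by
    matrices L and R_b of dimensions of Hom spaces.  The R_b commute with L, send
    the class of the unit to that of T_b, and are permuted by transposition:
    R_b^T is the matrix of the dual of T_b, because dim Hom(X, Y) is symmetric
    in a semisimple category and tensoring by dual objects gives adjoint
    functors.  Moreover L is not nilpotent, since U (x) Y = 0 implies Y = 0.  The
    claim becomes the statement of pure linear algebra [trace_nonnilpotent]: some
    L^(n+1) has a nonzero diagonal entry at the unit.

    For this, identify the commutant of the R_b with an algebra A of column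
    vectors; the entry at the unit is a trace t on A, and t(x x^T) = |x|^2 is
    positive.  If t vanished on all positive powers of L, it would vanish on
    every polynomial in L without constant term, hence on some nonzero
    idempotent e (Fitting).  But t(e) = t(p) where p is the orthogonal projection
    on the image of e, as e p = p and p e = e, and t(p) = |p|^2 > 0.

    An object X of D need not be simple: its dual Y in the ambient category is a
    direct sum of simple objects T, each of which has a dual U that is a summand
    of X; so the simple case puts all T, and hence Y, in D.  The case of the dual
    on the other side is obtained by reversing the tensor product. *)

Set Implicit Arguments.
Unset Strict Implicit.
Unset Printing Implicit Defensive.

Import Order.TTheory GRing.Theory Num.Theory.
Local Open Scope ring_scope.

(** * Traces of idempotents in a transpose-closed commutant *)

(** Write the characteristic polynomial as 'X^m * q with q(0) != 0.  A Bezout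
    relation between 'X^(m+1) and q gives a polynomial that acts as 1 on the
    part of the space where A is invertible and as 0 where A is nilpotent. *)
Lemma nonnilpotent_idempotent (F : fieldType) n (A : 'M[F]_n.+1) :
  (forall j, A ^+ j != 0) ->
  exists p : {poly F},
    let e := horner_mx A ('X * p) in e * e = e /\ e != 0.
Proof.
move=> nilA.
have [m [q]] := multiplicity_XsubC (char_poly A) 0.
rewrite monic_neq0 ?char_poly_monic //= polyC0 subr0 => q0 charA.
have /Bezout_eq1_coprimepP[[u v] /= uv1] : coprimep ('X^(m.+1)) q.
  by rewrite coprimep_expl // coprimep_sym -['X]subr0 -polyC0 coprimep_XsubC.
have killA (w : {poly F}) : horner_mx A (w * (q * 'X^m)) = 0.
  by rewrite rmorphM /= -charA (Cayley_Hamilton A) mulr0.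
exists ('X^m * u); rewrite mulrA -exprS /=.
set f := _ * u; split.
  apply/eqP; rewrite -subr_eq0 -rmorphM -rmorphB /=.
  suff -> : f * f - f = - ('X * u * v) * (q * 'X^m) by rewrite killA.
  have -> : f * f - f = - (f * (v * q)).
    by rewrite -[v * q](addKr (u * 'X^(m.+1))) uv1 /f; ring.
  by rewrite /f exprS; ring.
apply: contra_neq (nilA m.+1) => f0.
have <- : horner_mx A ('X^(m.+1) * (f + v * q)) = A ^+ m.+1.
  by rewrite /f [_ * u]mulrC uv1 mulr1 rmorphXn /= horner_mx_X.
rewrite rmorphM rmorphD /= f0 add0r -rmorphM /=.
suff -> : 'X^(m.+1) * (v * q) = 'X * v * (q * 'X^m) by rewrite killA.
by rewrite exprS; ring.
Qed.

Lemma gram_eq0 (F : realFieldType) m n (A : 'M[F]_(m, n)) :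
  A^T *m A = 0 -> A = 0.
Proof.
move=> A0; apply/matrixP => i j; rewrite mxE.
have /eqP := congr1 (fun M : 'M_n => M j j) A0.
rewrite !mxE psumr_eq0 => [/allP /(_ i (mem_index_enum i))|l _] /=.
  by rewrite mxE -expr2 sqrf_eq0 => /eqP.
by rewrite mxE -expr2 sqr_ge0.
Qed.

(** Least squares: e *m x is the orthogonal projection of y on the image of e.
    The equation is solvable because e^T *m e and e have the same kernel. *)
Lemma normal_equation (F : realFieldType) m n (e : 'M[F]_(m, n))
    (y : 'cV[F]_m) :
  exists x : 'cV[F]_n, e^T *m (y - e *m x) = 0.
Proof.
have /submxP[x eqx] : (y^T *m e <= e^T *m e)%MS.
  rewrite submxE -mulmxA; set c := cokermx _.
  suff -> : e *m c = 0 by rewrite mulmx0.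
  by apply: gram_eq0; rewrite trmx_mul -!mulmxA [e^T *m _]mulmxA mulmx_coker mulmx0.
exists x^T; rewrite mulmxBr; apply/eqP; rewrite subr_eq0; apply/eqP.
by apply: trmx_inj; rewrite !trmx_mul !trmxK eqx mulmxA.
Qed.

(** Think of the standard basis as the basis of a based ring with unit i0, and
    of R b as right multiplication by the basis element b.  A matrix commuting
    with all R b is then left multiplication by its column i0, and its entry at
    i0 is the coefficient of the unit, a positive definite trace. *)
Lemma trace_nonnilpotent (F : realFieldType) m (i0 : 'I_m)
    (R : 'I_m -> 'M[F]_m) (s : 'I_m -> 'I_m) (L : 'M[F]_m) :
  (forall b, R b *m delta_mx i0 0 = delta_mx b 0 :> 'cV_m) ->
  (forall b, (R b)^T = R (s b)) ->
  (forall b, L *m R b = R b *m L) ->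
  (forall j, L ^+ j != 0) ->
  exists j, (L ^+ j.+1) i0 i0 != 0.
Proof.
case: m i0 R s L => [[] //|m] i0 R s L Rd RT LR nilL.
pose d : 'cV[F]_m.+1 := delta_mx i0 0.
pose Rm (y : 'cV[F]_m.+1) := \sum_b y b 0 *: R b.
pose t (x : 'cV[F]_m.+1) := x i0 0.
(* Rm y *m x is the product x y of the based ring, and t is its trace. *)
have Rmd y : Rm y *m d = y.
  rewrite mulmx_suml [RHS]matrix_sum_delta; apply: eq_bigr => b _.
  by rewrite big_ord1 -scalemxAl Rd.
have ss b : s (s b) = b.
  have : delta_mx (s (s b)) 0 = delta_mx b 0 :> 'cV[F]_m.+1.
    by rewrite -[LHS]Rd -[RHS]Rd -!RT trmxK.
  move/(congr1 (fun x : 'cV_m.+1 => x b 0)); rewrite !mxE !eqxx !andbT.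
  case: eqP => // _ /eqP.
  by rewrite eq_sym oner_eq0.
have tdot x y : t (Rm y *m x) = \sum_b y b 0 * x (s b) 0.
  rewrite /t mulmx_suml summxE; apply: eq_bigr => b _.
  rewrite -scalemxAl mxE; congr (_ * _).
  have -> : R b *m x = (R (s b))^T *m x by rewrite RT ss.
  transitivity ((d^T *m ((R (s b))^T *m x)) 0 0).
    by rewrite trmx_delta -rowE !mxE.
  by rewrite mulmxA -trmx_mul Rd trmx_delta -rowE mxE.
have tC x y : t (Rm y *m x) = t (Rm x *m y).
  rewrite !tdot (reindex_inj (can_inj ss)) /=.
  by apply: eq_bigr => b _; rewrite ss mulrC.
have [p [ee e0]] := nonnilpotent_idempotent nilL.
set e := horner_mx L _ in ee e0.
have eR b : e *m R b = R b *m e.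
  by apply: comm_horner_mx; apply: LR.
have eTR b : e^T *m R b = R b *m e^T.
  by apply: trmx_inj; rewrite !trmx_mul !trmxK RT eR.
have eRm y : e *m Rm y = Rm y *m e.
  rewrite mulmx_sumr mulmx_suml; apply: eq_bigr => b _.
  by rewrite -scalemxAl -scalemxAr eR.
have eTRm y : e^T *m Rm y = Rm y *m e^T.
  rewrite mulmx_sumr mulmx_suml; apply: eq_bigr => b _.
  by rewrite -scalemxAl -scalemxAr eTR.
(* ep is the idempotent as a ring element, e *m x the orthogonal projection of
   the unit on the right ideal generated by ep, and q its complement. *)
have [x eq0] := normal_equation e d.
pose ep := e *m d; pose q := d - e *m x.
(* Rm ep *m q lies in the image of e and is orthogonal to it. *)
have qe : Rm ep *m q = 0.
  have im : Rm ep *m q = e *m (d - Rm ep *m x).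
    by rewrite !mulmxBr Rmd !mulmxA eRm.
  apply: gram_eq0; rewrite {1}im trmx_mul -mulmxA [e^T *m _]mulmxA eTRm.
  by rewrite -[_ *m e^T *m _]mulmxA eq0 !mulmx0.
(* The trace property replaces the idempotent by the orthogonal projection. *)
have tpp : t ep = ((e *m x)^T *m (e *m x)) 0 0.
  have -> : t ep = t (e *m x).
    have -> : e *m x = Rm (e *m x) *m ep.
      by rewrite /ep mulmxA -eRm -mulmxA Rmd mulmxA -[e *m e]/(e * e) ee.
    rewrite tC; congr t; rewrite -{1}[ep]Rmd -[d](subrK (e *m x)) mulmxDr.
    by rewrite -/q qe add0r.
  rewrite /t trmx_mul -mulmxA.
  have -> : e^T *m (e *m x) = e^T *m d.
    by apply/esym/eqP; rewrite -subr_eq0 -mulmxBr eq0.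
  by rewrite mulmxA -trmx_mul -colE !mxE.
have tep0 : t ep != 0.
  apply: contra_neq e0; rewrite tpp => ex0.
  have {}ex0 : e *m x = 0.
    by apply: gram_eq0; apply/matrixP => i j; rewrite !ord1 ex0 mxE.
  have dq : d = q by rewrite /q ex0 subr0.
  have ep0 : ep = 0 by rewrite -[ep]Rmd dq.
  apply/matrixP => i j; rewrite mxE.
  have : e *m (Rm (delta_mx j 0) *m d) = 0.
    by rewrite mulmxA eRm -mulmxA -/ep ep0 mulmx0.
  by rewrite Rmd -colE => /colP/(_ i); rewrite !mxE.
(* e is a combination of positive powers of L. *)
have [//|/forallNP tL0] := pselect (exists j, (L ^+ j.+1) i0 i0 != 0).
case/eqP: tep0; rewrite /t /ep -colE mxE /e.
rewrite -[p]coefK poly_def mulr_sumr rmorph_sum summxE big1 // => i _.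
rewrite -mul_polyC mulrCA -exprS rmorphM rmorphXn /= horner_mx_C horner_mx_X.
rewrite [_ * _]mul_scalar_mx mxE.
by have /negP/negPn/eqP-> := tL0 i; rewrite mulr0.
Qed.

(** * Coherence and reversal of the tensor product *)

Section Coherence.
Variables (k : fieldType) (C : tensorCat k).
Implicit Types X Y Z W A B : C.

Lemma left_right_inverse X Y (f : hom X Y) (g h : hom Y X) :
  g \oc f = idm X -> f \oc h = idm Y -> g = h.
Proof. by move=> gf fh; rewrite -[g]cmpm1 -fh cmpA gf cmp1m. Qed.

Lemma tensm_cmpl X X' X'' Y (g : hom X' X'') (f : hom X X') :
  (g \oc f) \otm idm Y = (g \otm idm Y) \oc (f \otm idm Y).
Proof. by rewrite -tensm_cmp cmp1m. Qed.

Lemma tensm_cmpr X Y Y' Y'' (g : hom Y' Y'') (f : hom Y Y') :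
  idm X \otm (g \oc f) = (idm X \otm g) \oc (idm X \otm f).
Proof. by rewrite -tensm_cmp cmp1m. Qed.

Lemma tensm_exchange X X' Y Y' (f : hom X X') (g : hom Y Y') :
  (f \otm idm Y') \oc (idm X \otm g) = (idm X' \otm g) \oc (f \otm idm Y).
Proof. by rewrite -!tensm_cmp !cmp1m !cmpm1. Qed.

Lemma assocV_nat X X' Y Y' Z Z' (f : hom X X') (g : hom Y Y') (h : hom Z Z') :
  assocV X' Y' Z' \oc (f \otm (g \otm h))
  = ((f \otm g) \otm h) \oc assocV X Y Z.
Proof.
rewrite -[LHS]cmpm1 -(assocVK X Y Z) cmpA -[_ \oc _ \oc assoc X Y Z]cmpA.
by rewrite -assoc_nat cmpA assocK cmp1m.
Qed.

Lemma runitV_nat X Y (f : hom X Y) :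
  runitV Y \oc f = (f \otm idm unitob) \oc runitV X.
Proof.
rewrite -[LHS]cmpm1 -(runitVK X) cmpA -[_ \oc _ \oc runit X]cmpA.
by rewrite -runit_nat cmpA runitK cmp1m.
Qed.

Lemma pentagonV X Y Z W :
  assocV (X \ot Y) Z W \oc assocV X Y (Z \ot W)
  = (assocV X Y Z \otm idm W) \oc assocV X (Y \ot Z) W
    \oc (idm X \otm assocV Y Z W).
Proof.
apply: (@left_right_inverse _ _ (assoc X Y (Z \ot W) \oc assoc (X \ot Y) Z W)).
  by rewrite cmpA -[_ \oc _ \oc assoc X Y _]cmpA assocK cmpm1 assocK.
rewrite pentagon !cmpA -[_ \oc _ \oc (assocV _ _ _ \otm _)]cmpA -tensm_cmpl.
rewrite assocVK tensm_id cmpm1 -[_ \oc _ \oc assocV _ _ _]cmpA assocVK cmpm1.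
by rewrite -tensm_cmpr assocVK tensm_id.
Qed.

Lemma triangleV X Y :
  (runit X \otm idm Y) \oc assocV X unitob Y = idm X \otm lunit Y.
Proof. by rewrite -triangle -cmpA assocVK cmpm1. Qed.

Lemma tensm_unit_inj X Y (f g : hom X Y) :
  f \otm idm unitob = g \otm idm unitob -> f = g.
Proof.
move=> fg; rewrite -[f]cmpm1 -[g]cmpm1 -(runitVK X) !cmpA -!runit_nat.
by rewrite fg.
Qed.

(** Kelly's lemma: after tensoring with the unit, which is faithful, this
    follows from the pentagon for X, Y, 1, 1 and the triangle. *)
Lemma runit_tens X Y : runit (X \ot Y) = (idm X \otm runit Y) \oc assoc X Y unitob.
Proof.
apply: tensm_unit_inj; rewrite -[LHS]cmp1m -[RHS]cmp1m -(assocK X Y unitob).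
rewrite -!cmpA; congr (_ \oc _).
rewrite -triangle cmpA -tensm_id assoc_nat -cmpA pentagon.
rewrite !cmpA -tensm_cmpr triangle -assoc_nat.
by rewrite tensm_cmpl !cmpA.
Qed.

(** Same linear category, opposite order of the factors: this exchanges left
    and right duals, and transports one-sided statements to the other side. *)
Definition rev_tensor : tensorCat k :=
  @TensorCat k C (@tc_additive k C) unitob
    (fun X Y => Y \ot X)
    (fun _ _ _ _ f g => g \otm f)
    (fun X Y => tensm_id Y X)
    (fun _ _ _ _ _ _ f' f g' g => tensm_cmp g' g f' f)
    (fun _ _ _ _ f => @tensm_linearl k C _ _ _ _ f)
    (fun _ _ _ _ g => @tensm_linearr k C _ _ _ _ g)
    (fun X Y Z => assocV Z Y X) (fun X Y Z => assoc Z Y X)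
    (fun X Y Z => assocVK Z Y X) (fun X Y Z => assocK Z Y X)
    (fun _ _ _ _ _ _ f g h => assocV_nat h g f)
    (fun X => runit X) (fun X => runitV X)
    (@runitK k C) (@runitVK k C) (@runit_nat k C)
    (fun X => lunit X) (fun X => lunitV X)
    (@lunitK k C) (@lunitVK k C) (@lunit_nat k C)
    (fun X Y Z W => pentagonV W Z Y X) (fun X Y => triangleV Y X).

Lemma left_dual_rev X Y : @left_dual k C X Y -> @left_dual k rev_tensor Y X.
Proof. by move=> [ev [coev [zX zY]]]; exists ev, coev. Qed.

End Coherence.

Lemma runitV_tens (k : fieldType) (C : tensorCat k) (X Y : C) :
  runitV (X \ot Y) = assocV X Y unitob \oc (idm X \otm runitV Y).
Proof.
apply: left_right_inverse; first exact: runitK.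
rewrite runit_tens cmpA -[_ \oc _ \oc assocV _ _ _]cmpA assocVK cmpm1.
by rewrite -tensm_cmpr runitVK tensm_id.
Qed.

(** * Duals give adjoint functors *)

Section Adjunction.
Variables (k : fieldType) (C : tensorCat k).
Implicit Types X Y Z W A B : C.

(** Here and in the next lemma, tensoring a zigzag identity with A or B on the
    left yields a triangle identity of the adjunction between - (x) X and
    - (x) Y. *)
Lemma zigzag_left X Y (ev : hom (Y \ot X) unitob)
    (coev : hom unitob (X \ot Y)) A :
  runit X \oc (idm X \otm ev) \oc assoc X Y X
    \oc (coev \otm idm X) \oc lunitV X = idm X ->
  runit (A \ot X) \oc (idm (A \ot X) \otm ev) \oc assoc (A \ot X) Y X
    \oc (assocV A X Y \otm idm X) \oc ((idm A \otm coev) \otm idm X)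
    \oc (runitV A \otm idm X) = idm (A \ot X).
Proof.
move=> zX; rewrite runit_tens -(tensm_id A X).
rewrite -[_ \oc assoc A X unitob \oc _]cmpA assoc_nat !cmpA.
rewrite -[_ \oc assoc A X _ \oc _]cmpA pentagon !cmpA.
rewrite -[_ \oc (assoc A X Y \otm _) \oc _]cmpA -tensm_cmpl assocVK tensm_id.
rewrite cmpm1 -[_ \oc assoc A _ X \oc _]cmpA assoc_nat !cmpA.
have triV : assoc A unitob X \oc (runitV A \otm idm X) = idm A \otm lunitV X.
  apply/esym/(@left_right_inverse _ _ _ _ (idm A \otm lunit X)).
    by rewrite -tensm_cmpr lunitK tensm_id.
  by rewrite cmpA triangle -tensm_cmpl runitVK tensm_id.
rewrite -[_ \oc assoc A _ X \oc _]cmpA triV.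
by rewrite -!tensm_cmpr zX tensm_id.
Qed.

Lemma zigzag_right X Y (ev : hom (Y \ot X) unitob)
    (coev : hom unitob (X \ot Y)) B :
  lunit Y \oc (ev \otm idm Y) \oc assocV Y X Y
    \oc (idm Y \otm coev) \oc runitV Y = idm Y ->
  (runit B \otm idm Y) \oc ((idm B \otm ev) \otm idm Y)
    \oc (assoc B Y X \otm idm Y) \oc assocV (B \ot Y) X Y
    \oc (idm (B \ot Y) \otm coev) \oc runitV (B \ot Y) = idm (B \ot Y).
Proof.
move=> zY; rewrite runitV_tens -(tensm_id B Y) !cmpA.
rewrite -[_ \oc _ \oc assocV B Y unitob]cmpA -assocV_nat !cmpA.
rewrite -[_ \oc _ \oc assocV B Y _]cmpA pentagonV !cmpA.
rewrite -[_ \oc (assoc B Y X \otm _) \oc _]cmpA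
  -[(assoc B Y X \otm _) \oc _]tensm_cmpl assocVK tensm_id.
rewrite cmpm1 -[_ \oc _ \oc assocV B _ Y]cmpA -assocV_nat !cmpA triangleV.
by rewrite -!tensm_cmpr zY tensm_id.
Qed.

Lemma left_dual_adjunction X Y A B : left_dual X Y ->
  exists (f : hom (A \ot X) B -> hom A (B \ot Y))
         (g : hom A (B \ot Y) -> hom (A \ot X) B),
   [/\ linear f, cancel f g & cancel g f].
Proof.
move=> [ev [coev [zX zY]]].
exists (fun f => (f \otm idm Y) \oc assocV A X Y \oc (idm A \otm coev)
  \oc runitV A).
exists (fun g => runit B \oc (idm B \otm ev) \oc assoc B Y X
  \oc (g \otm idm X)).
split.
- by move=> a u v; rewrite tensm_linearl !cmp_linearl.
- move=> f; rewrite !tensm_cmpl !cmpA.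
  rewrite -[_ \oc assoc B Y X \oc _]cmpA assoc_nat tensm_id !cmpA.
  rewrite -[runit B \oc _ \oc (f \otm _)]cmpA -tensm_exchange cmpA runit_nat.
  by have := congr1 (cmp f) (zigzag_left A zX); rewrite !cmpA cmpm1.
- move=> g; rewrite !tensm_cmpl.
  rewrite -[_ \oc assocV A X Y]cmpA -assocV_nat tensm_id !cmpA.
  rewrite -[_ \oc (g \otm _) \oc _]cmpA tensm_exchange cmpA.
  rewrite -[_ \oc (g \otm _) \oc _]cmpA -runitV_nat cmpA.
  by rewrite (zigzag_right B zY) cmp1m.
Qed.

End Adjunction.

Lemma left_dual_adjunction_rev (k : fieldType) (C : tensorCat k) (X Y A B : C) :
  left_dual X Y ->
  exists (f : hom (Y \ot A) B -> hom A (X \ot B))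
         (g : hom A (X \ot B) -> hom (Y \ot A) B),
   [/\ linear f, cancel f g & cancel g f].
Proof.
move/left_dual_rev => dYX.
exact: (@left_dual_adjunction k (rev_tensor C) Y X A B dYX).
Qed.

(** * Dimension of abstract modules over a field *)

Section Dimension.
Variable k : fieldType.
Implicit Types V W : lmodType k.

(** The spaces of morphisms are bare modules; a basis given with its coordinate
    functionals is the form that direct sums of modules preserve most easily. *)
Definition dual_basis V (I : finType) (e : I -> V) (c : I -> V -> k) : Prop :=
  [/\ forall i, scalar (c i),
      forall i j, c i (e j) = (i == j)%:R
    & forall v, v = \sum_i c i v *: e i].

Definition has_dim V (n : nat) : Prop :=
  exists (I : finType) (e : I -> V) (c : I -> V -> k),
    #|I| = n /\ dual_basis e c.

Lemma linear_0 V W (f : V -> W) : linear f -> f 0 = 0.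
Proof. by move=> /(_ (-1) 0 0); rewrite scaler0 addr0 scaleN1r addNr. Qed.

Lemma linear_sumZ V W (f : V -> W) (I : finType) (a : I -> k) (v : I -> V) :
  linear f -> f (\sum_i a i *: v i) = \sum_i a i *: f (v i).
Proof.
move=> lf; have f0 := linear_0 lf.
by elim/big_rec2: _ => [//|i x y _ <-]; rewrite lf.
Qed.

Lemma scalar_sumZ V (f : V -> k) (I : finType) (a : I -> k) (v : I -> V) :
  scalar f -> f (\sum_i a i *: v i) = \sum_i a i * f (v i).
Proof. exact: (@linear_sumZ V k^o). Qed.

Lemma scalar_0 V (f : V -> k) : scalar f -> f 0 = 0.
Proof. exact: (@linear_0 V k^o). Qed.

Lemma scalar_Z V (f : V -> k) a v : scalar f -> f (a *: v) = a * f v.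
Proof. by move=> lf; rewrite -[a *: v]addr0 lf scalar_0 // addr0. Qed.

(** Both numbers are the trace of the identity, computed in either basis; in
    characteristic 0 the trace determines them. *)
Lemma has_dim_uniq V m n :
  [pchar k] =i pred0 -> has_dim V m -> has_dim V n -> m = n.
Proof.
move=> /pcharf0P k0 [I [e [c [<- [cl ce ve]]]]] [J [e' [c' [<- [cl' ce' ve']]]]].
have mixed (K L : finType) (u : K -> V) (a : K -> V -> k) (w : L -> V)
    (b : L -> V -> k) : dual_basis u a -> dual_basis w b ->
    #|K|%:R = \sum_i \sum_j b j (u i) * a i (w j).
  move=> [al au _] [_ _ wb].
  rewrite -sum1_card natr_sum; apply: eq_bigr => i _.
  by rewrite -scalar_sumZ // -wb au eqxx.
have {mixed} mn : #|I|%:R = #|J|%:R :> k.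
  rewrite (mixed _ _ e c e' c') // (mixed _ _ e' c' e c) // exchange_big /=.
  by do 2!apply: eq_bigr => ? _; rewrite mulrC.
wlog leIJ : I J {e c cl ce ve e' c' cl' ce' ve'} mn / (#|I| <= #|J|)%N.
  by move=> H; have [/H->|/ltnW/H->] := leqP #|I| #|J|.
apply/eqP; rewrite eqn_leq leIJ -subn_eq0 -k0 natrB //.
by rewrite mn subrr eqxx.
Qed.

Lemma has_dim_iso V W (f : V -> W) (g : W -> V) n :
  linear f -> cancel f g -> cancel g f -> has_dim V n -> has_dim W n.
Proof.
move=> lf fK gK [I [e [c [cardI [cl ce ve]]]]].
exists I, (f \o e), (fun i => c i \o g); split=> //; split=> [i a u v|i j|w] /=.
- by rewrite -cl -{1}[u]gK -{1}[v]gK -lf fK.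
- by rewrite fK ce.
- by rewrite -linear_sumZ // -ve gK.
Qed.

Lemma has_dim_rV V n (f : {linear V -> 'rV[k]_n}) : bijective f -> has_dim V n.
Proof.
move=> [g fK gK]; apply: (@has_dim_iso 'rV[k]_n V g f) => //.
  by move=> a u v; apply: (can_inj fK); rewrite linearP !gK.
exists 'I_n, (fun i => delta_mx 0 i), (fun i (u : 'rV_n) => u 0 i).
split; first exact: card_ord.
split=> [i a u v|i j|u]; rewrite ?mxE ?eqxx //.
exact: row_sum_delta.
Qed.

(** The decomposition of V is given by injections and projections, as for the
    direct sums of a linear category, to which this is applied below. *)
Lemma has_dim_sum V (I : finType) (W : I -> lmodType k) (n : I -> nat)
    (u : forall a, W a -> V) (q : forall a, V -> W a) :
  (forall a, linear (u a)) -> (forall a, linear (q a)) ->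
  (forall a w, q a (u a w) = w) ->
  (forall a b w, a <> b -> q b (u a w) = 0) ->
  (forall v, v = \sum_a u a (q a v)) ->
  (forall a, has_dim (W a) (n a)) -> has_dim V (\sum_a n a).
Proof.
move=> ul ql qu qu0 vE dW.
pose J a := sval (cid (dW a)).
pose e a := sval (cid (svalP (cid (dW a)))) : J a -> W a.
pose c a := sval (cid (svalP (cid (svalP (cid (dW a)))))) : J a -> W a -> k.
have cardJ a : #|J a| = n a.
  by have [] := svalP (cid (svalP (cid (svalP (cid (dW a)))))).
have ec a : dual_basis (e a) (c a).
  by have [] := svalP (cid (svalP (cid (svalP (cid (dW a)))))).
clearbody J e c.
exists {a : I & J a}, (fun x => u _ (e _ (tagged x))),
  (fun x v => c _ (tagged x) (q _ v)); split.
  by rewrite card_tagged sumnE big_map big_enum; apply: eq_bigr.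
split=> [[a i] b v w /=|[a i] [b j] /=|v].
- by rewrite ql; have [-> _ _] := ec a.
- have [cl ce _] := ec a; have [ab|/eqP/nesym ab] := eqVneq a b.
    by subst b; rewrite qu ce eq_Tagged.
  by rewrite qu0 //= scalar_0 //; case: eqP => // [[/esym]].
rewrite [LHS]vE (eq_bigr (fun a => \sum_i c a i (q a v) *: u a (e a i))).
  by rewrite sig_big_dep /=.
move=> a _; have [_ _ ve] := ec a; rewrite {1}[q a v]ve; exact: linear_sumZ.
Qed.

End Dimension.

(** * Retracts and direct sums in linear categories *)

(** In an abelian category this is the same as a direct summand; no complement
    has to be carried along. *)
Definition retract (k : fieldType) (C : preLinCat k) (Y X : C) : Prop :=
  exists (i : hom Y X) (p : hom X Y), p \oc i = idm Y.

Section LinearCategory.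
Variables (k : fieldType) (C : preLinCat k).
Implicit Types X Y Z A : C.

Lemma cmp0m X Y Z (f : hom X Y) : (0 : hom Y Z) \oc f = 0.
Proof. exact: (@linear_0 _ _ _ (fun g : hom Y Z => g \oc f) (cmp_linearl f)). Qed.

Lemma cmpm0 X Y Z (g : hom Y Z) : g \oc (0 : hom X Y) = 0.
Proof. exact: (@linear_0 _ _ _ (fun f : hom X Y => g \oc f) (cmp_linearr g)). Qed.

Lemma cmpDr X Y Z (g : hom Y Z) (u v : hom X Y) :
  g \oc (u + v) = g \oc u + g \oc v.
Proof. by have := cmp_linearr g 1 u v; rewrite !scale1r. Qed.

Lemma cmpDl X Y Z (f : hom X Y) (u v : hom Y Z) :
  (u + v) \oc f = u \oc f + v \oc f.
Proof. by have := cmp_linearl f 1 u v; rewrite !scale1r. Qed.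

Lemma cmpZl X Y Z (f : hom X Y) a (u : hom Y Z) : (a *: u) \oc f = a *: (u \oc f).
Proof. by have := cmp_linearl f a u 0; rewrite cmp0m !addr0. Qed.

Lemma cmpBr X Y Z (g : hom Y Z) (u v : hom X Y) :
  g \oc (u - v) = g \oc u - g \oc v.
Proof. by have := cmp_linearr g (-1) v u; rewrite !scaleN1r ![- _ + _]addrC. Qed.

Lemma cmpBl X Y Z (f : hom X Y) (u v : hom Y Z) :
  (u - v) \oc f = u \oc f - v \oc f.
Proof. by have := cmp_linearl f (-1) v u; rewrite !scaleN1r ![- _ + _]addrC. Qed.

Lemma cmp_sumr X Y Z (g : hom Y Z) (I : finType) (v : I -> hom X Y) :
  g \oc (\sum_i v i) = \sum_i g \oc v i.
Proof. by elim/big_rec2: _ => [|i x y _ <-]; rewrite ?cmpm0 ?cmpDr. Qed.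

Lemma cmp_suml X Y Z (f : hom X Y) (I : finType) (v : I -> hom Y Z) :
  (\sum_i v i) \oc f = \sum_i v i \oc f.
Proof. by elim/big_rec2: _ => [|i x y _ <-]; rewrite ?cmp0m ?cmpDl. Qed.

Lemma isomorphic_refl X : isomorphic X X.
Proof. by exists (idm X), (idm X); rewrite cmp1m. Qed.

Lemma isomorphic_sym X Y : isomorphic X Y -> isomorphic Y X.
Proof. by move=> [f [g [gf fg]]]; exists g, f. Qed.

Lemma isomorphic_trans X Y Z : isomorphic X Y -> isomorphic Y Z -> isomorphic X Z.
Proof.
move=> [f [g [gf fg]]] [f' [g' [gf' fg']]]; exists (f' \oc f), (g \oc g').
by rewrite !cmpA -[g \oc _ \oc _]cmpA gf' cmpm1 gf -[_ \oc f \oc g]cmpA fg cmpm1.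
Qed.

Lemma direct_sum_isomorphic (I : finType) (S S' : I -> C) X :
  (forall a, isomorphic (S a) (S' a)) -> is_direct_sum S X -> is_direct_sum S' X.
Proof.
move=> iso [i [p [pi pi0 ipE]]].
pose f a := sval (cid (iso a)).
pose g a := sval (cid (svalP (cid (iso a)))).
have fg a : f a \oc g a = idm _ by have [] := svalP (cid (svalP (cid (iso a)))).
have gf a : g a \oc f a = idm _ by have [] := svalP (cid (svalP (cid (iso a)))).
exists (fun a => i a \oc g a), (fun a => f a \oc p a).
split=> [a|a b ab|].
- by rewrite !cmpA -[_ \oc p a \oc i a]cmpA pi cmpm1 fg.
- by rewrite !cmpA -[_ \oc p b \oc i a]cmpA pi0 // cmpm0 cmp0m.
rewrite -ipE; apply: eq_bigr => a _.
by rewrite !cmpA -[_ \oc g a \oc f a]cmpA gf cmpm1.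
Qed.

Lemma isomorphic_retract X Y : isomorphic X Y -> retract X Y.
Proof. by move=> [f [g [gf _]]]; exists f, g. Qed.

Lemma retract_trans X Y Z : retract X Y -> retract Y Z -> retract X Z.
Proof.
move=> [i [p pi]] [j [q qj]]; exists (j \oc i), (p \oc q).
by rewrite !cmpA -[_ \oc q \oc j]cmpA qj cmpm1.
Qed.

(** The complement is the kernel of the retraction. *)
Lemma retract_summand X Y : abelian_cat C -> retract Y X -> direct_summand Y X.
Proof.
move=> [_ ker _ _ _] [i [p pi]]; have [K [j [pj univ]]] := ker _ _ p.
have [|r [jr _]] := univ X (idm X - i \oc p).
  by rewrite cmpBr cmpm1 cmpA pi cmp1m subrr.
have cancel_j Z (u v : hom Z K) : j \oc u = j \oc v -> u = v.
  move=> juv; have [|w [_ uniq_w]] := univ Z (j \oc u).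
    by rewrite cmpA pj cmp0m.
  by rewrite -(uniq_w u) // -(uniq_w v).
exists K, (fun b => if b as b return hom (if b then Y else K) X then i else j).
exists (fun b => if b as b return hom X (if b then Y else K) then p else r).
split=> [[] //|[] [] //= _|].
- by apply: cancel_j; rewrite cmpA jr cmpBl -cmpA pj cmpm0 subr0 cmp1m cmpm1.
- by apply: cancel_j; rewrite cmpA jr cmpBl -cmpA pi cmp1m cmpm1 subrr cmpm0.
by rewrite big_bool jr /= addrC subrK.
Qed.

End LinearCategory.

(** * Dimensions of spaces of morphisms *)

Section HomDimension.
Variables (k : fieldType) (C : preLinCat k).
Implicit Types X Y Z A : C.
Hypothesis k0 : [pchar k] =i pred0.
Hypothesis fin : finite_dim_homs C.

Lemma hom_has_dim X Y : exists n, has_dim (hom X Y) n.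
Proof. by have [n [f /has_dim_rV]] := fin X Y; exists n. Qed.

Definition dimhom X Y : nat := sval (cid (hom_has_dim X Y)).

Lemma dimhomP X Y n : has_dim (hom X Y) n -> dimhom X Y = n.
Proof. by apply: has_dim_uniq => //; apply: svalP (cid _). Qed.

Lemma dimhom_has_dim X Y : has_dim (hom X Y) (dimhom X Y).
Proof. exact: svalP (cid _). Qed.

Lemma dimhom_iso X Y X' Y' (f : hom X Y -> hom X' Y') (g : hom X' Y' -> hom X Y) :
  linear f -> cancel f g -> cancel g f -> dimhom X Y = dimhom X' Y'.
Proof.
by move=> lf fK gK; apply/esym/dimhomP/(has_dim_iso lf fK gK)/dimhom_has_dim.
Qed.

Lemma dimhom_sumr (I : finType) (S : I -> C) A X :
  is_direct_sum S X -> dimhom A X = \sum_a dimhom A (S a).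
Proof.
move=> [i [p [pi pi0 ipE]]]; apply: dimhomP.
apply: (@has_dim_sum _ (hom A X) _ (fun a => hom A (S a)) _
  (fun a f => i a \oc f) (fun a f => p a \oc f)).
- by move=> a; apply: cmp_linearr.
- by move=> a; apply: cmp_linearr.
- by move=> a f; rewrite cmpA pi cmp1m.
- by move=> a b f ab; rewrite cmpA pi0 // cmp0m.
- by move=> f; rewrite -[LHS]cmp1m -ipE cmp_suml; apply: eq_bigr => a _; rewrite cmpA.
- by move=> a; apply: dimhom_has_dim.
Qed.

Lemma dimhom_suml (I : finType) (S : I -> C) A X :
  is_direct_sum S X -> dimhom X A = \sum_a dimhom (S a) A.
Proof.
move=> [i [p [pi pi0 ipE]]]; apply: dimhomP.
apply: (@has_dim_sum _ (hom X A) _ (fun a => hom (S a) A) _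
  (fun a f => f \oc p a) (fun a f => f \oc i a)).
- by move=> a; apply: cmp_linearl.
- by move=> a; apply: cmp_linearl.
- by move=> a f; rewrite -cmpA pi cmpm1.
- by move=> a b f ab; rewrite -cmpA pi0 ?cmpm0 // => /esym.
- by move=> f; rewrite -[LHS]cmpm1 -ipE cmp_sumr; apply: eq_bigr => a _; rewrite cmpA.
- by move=> a; apply: dimhom_has_dim.
Qed.

Lemma dimhom_eq0 X Y : dimhom X Y = 0%N <-> forall f : hom X Y, f = 0.
Proof.
split=> [h0 f|z].
  have [I [e [c [/eqP]]]] := dimhom_has_dim X Y.
  rewrite h0 => /eqP/card0_eq I0 [_ _ ve]; rewrite [f]ve; apply: big1 => i.
  by have := I0 i.
apply: dimhomP; exists void, (fun=> 0), (fun _ _ => 0); split; first exact: card_void.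
by split=> [[]|[]|v]; rewrite [LHS]z [RHS]z.
Qed.

Lemma idm0_dim X A : idm X = 0 -> dimhom A X = 0%N.
Proof. by move=> X0; apply/dimhom_eq0 => f; rewrite -[f]cmp1m X0 cmp0m. Qed.

End HomDimension.

(** * Schur's lemma and simple objects *)

Section Schur.
Variables (k : closedFieldType) (C : preLinCat k).
Implicit Types X Y Z A : C.

Lemma simple_isomorphic X Y : isomorphic X Y -> simple_object X -> simple_object Y.
Proof.
move=> [f [g [gf fg]]] [X0 monoX]; split=> [[Y0 Y0']|Z m mono_m].
  apply: X0; split=> A h; first by rewrite -[h]cmp1m -gf -cmpA (Y0 _ (f \oc h)) cmpm0.
  by rewrite -[h]cmpm1 -gf cmpA (Y0' _ (h \oc g)) cmp0m.
have [||[g' [gm mg]]] := monoX Z (g \oc m).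
- move=> A u v /(congr1 (cmp f)); rewrite -!cmpA !(cmpA f) fg !cmp1m; exact: mono_m.
- by left.
right; exists (g' \oc g); rewrite -cmpA; split=> //.
by rewrite -[LHS]cmp1m -fg -cmpA (cmpA g) (cmpA (g \oc m)) mg cmp1m.
Qed.

Hypothesis abC : abelian_cat C.

Lemma simple_hom_iso X Y (f : hom X Y) :
  simple_object X -> simple_object Y -> f <> 0 -> is_iso f.
Proof.
move=> [X0 monoX] [Y0 monoY] f0; have [_ ker _ _ _] := abC.
have [K [i [fi univ]]] := ker _ _ f.
have mono_i : mono i.
  move=> Z u v iuv; have [|w [_ uniq_w]] := univ Z (i \oc u).
    by rewrite cmpA fi cmp0m.
  by rewrite -(uniq_w u) // -(uniq_w v).
have mono_f : mono f.
  have [[K0 _]|[i' [_ ii']]] := monoX _ i mono_i; last first.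
    by case: f0; rewrite -[f]cmpm1 -ii' cmpA fi cmp0m.
  move=> Z u v fuv; have [|w [iw _]] := univ Z (u - v).
    by rewrite cmpBr fuv subrr.
  by apply/eqP; rewrite -subr_eq0 -iw (K0 _ w) cmpm0.
by have [] := monoY _ f mono_f.
Qed.

Hypothesis k0 : [pchar k] =i pred0.
Hypothesis fin : finite_dim_homs C.

Lemma idm_simple_neq0 X : simple_object X -> idm X <> 0.
Proof.
move=> [X0 _] id0; apply: X0; split=> A f; first by rewrite -[f]cmp1m id0 cmp0m.
by rewrite -[f]cmpm1 id0 cmpm0.
Qed.

(** Composition with f on the finite-dimensional space of endomorphisms has an
    eigenvector g, so f - a is not invertible, hence zero by Schur's lemma. *)
Lemma simple_endo X (f : hom X X) : simple_object X -> exists a, f = a *: idm X.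
Proof.
move=> sX; have [I [e [c [cardI [cl ce ve]]]]] := dimhom_has_dim fin X X.
(* The matrix, for row vectors, of composition with f. *)
pose M : 'M[k]_#|I| := \matrix_(i, j) c (enum_val j) (f \oc e (enum_val i)).
have I0 : (0 < #|I|)%N.
  rewrite lt0n; apply/eqP => /card0_eq I0; apply: (idm_simple_neq0 sX).
  by rewrite [idm X]ve big1 // => i; have := I0 i.
have /closed_rootP[a] : size (char_poly M) != 1%N.
  by rewrite size_char_poly eqSS -lt0n.
rewrite -eigenvalue_root_char => /eigenvalueP[v vM v0].
pose g := \sum_i v 0 i *: e (enum_val i).
have cg i : c (enum_val i) g = v 0 i.
  rewrite scalar_sumZ // (bigD1 i) //= ce eqxx mulr1 big1 ?addr0 // => j ji.
  by rewrite ce (inj_eq enum_val_inj) eq_sym (negPf ji) mulr0.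
have fg : f \oc g = a *: g.
  rewrite (@linear_sumZ _ _ _ (fun g => f \oc g)); last exact: cmp_linearr.
  rewrite [LHS]ve [RHS]ve; apply: eq_bigr => j _; congr (_ *: _).
  rewrite -[j](enum_rankK j) scalar_sumZ // scalar_Z // cg.
  have /rowP/(_ (enum_rank j)) := vM; rewrite !mxE => <-.
  by apply: eq_bigr => i _; rewrite mxE.
exists a; apply: contrapT => fa.
have [|h [hf fh]] := simple_hom_iso sX sX (f := f - a *: idm X).
  by move/eqP; rewrite subr_eq0 => /eqP.
have g0 : g = 0.
  rewrite -[g]cmp1m -hf -cmpA cmpBl fg.
  by rewrite cmpZl cmp1m subrr cmpm0.
by case/eqP: v0; apply/rowP => i; rewrite -cg g0 mxE scalar_0.
Qed.

Lemma dimhom_simple_self X : simple_object X -> dimhom fin X X = 1%N.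
Proof.
move=> sX; have [I [e [c [cardI [cl ce ve]]]]] := dimhom_has_dim fin X X.
have [i ci0] : exists i, c i (idm X) != 0.
  apply: contrapT => /forallNP c0; apply: (idm_simple_neq0 sX).
  by rewrite [idm X]ve big1 // => i _; have /negP/negPn/eqP-> := c0 i; rewrite scale0r.
apply: dimhomP => //; exists unit, (fun=> idm X), (fun _ f => c i f / c i (idm X)).
split; first exact: card_unit.
split=> [_ a u v|[] []|f]; first by rewrite cl mulrDl mulrA.
  by rewrite divff.
have [a ->] := simple_endo f sX.
rewrite (big_pred1 tt) => [|[] //]; congr (_ *: _).
by rewrite scalar_Z // mulfK.
Qed.

Lemma dimhom_simple_neq X Y :
  simple_object X -> simple_object Y -> ~ isomorphic X Y -> dimhom fin X Y = 0%N.
Proof.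
move=> sX sY nXY; apply/dimhom_eq0 => // f; apply: contrapT => f0.
by apply: nXY; exists f; apply: simple_hom_iso.
Qed.

Hypothesis ssC : semisimple_cat C.
Hypothesis finC : finitely_many_simples C.

(** Apart from the simplicity of the unit, simple objects enter the rest only
    through this statement: dimensions of Hom spaces detect all that is needed. *)
Lemma simple_representatives : exists m (T : 'I_m -> C),
  (forall i j, dimhom fin (T i) (T j) = (i == j)) /\
  forall X, exists n (l : 'I_n -> 'I_m), is_direct_sum (fun a => T (l a)) X.
Proof.
have [n [S Sall]] := finC.
(* Keep the simple objects of the given list that repeat no earlier one. *)
pose P (a : 'I_n) := `[<simple_object (S a)>] &&
  [forall b : 'I_n, (b < a)%N ==> ~~ `[<isomorphic (S b) (S a)>]].
pose T (i : 'I_#|P|) := S (enum_val i).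
have sT i : simple_object (T i) by have /andP[/asboolP] := enum_valP i.
have T_inj i j : isomorphic (T i) (T j) -> i = j.
  move=> Tij; apply/enum_val_inj/val_inj => /=.
  have lt_notiso (i' j' : 'I_#|P|) : isomorphic (T i') (T j') ->
      ~~ (enum_val i' < enum_val j')%N.
    have /andP[_ /forallP/(_ (enum_val i'))/implyP H] := enum_valP j'.
    by move=> iso; apply/negP => /H /negP; apply; apply/asboolP.
  have := lt_notiso _ _ Tij; have := lt_notiso _ _ (isomorphic_sym Tij).
  by case: ltngtP.
have T_all X : simple_object X -> exists i, isomorphic X (T i).
  move=> sX; have [a0 Xa0] := Sall X sX.
  have Pa0 : `[<isomorphic X (S a0)>] by apply/asboolP.
  case: (@arg_minnP _ a0 (fun a => `[<isomorphic X (S a)>]) val Pa0).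
  move=> a /asboolP Xa min_a.
  have Pa : P a.
    apply/andP; split; first by apply/asboolP; apply: simple_isomorphic sX.
    apply/forallP => b; apply/implyP; rewrite ltnNge; apply: contra => /asboolP ba.
    apply/min_a/asboolP/(isomorphic_trans Xa); exact: isomorphic_sym.
  by exists (enum_rank_in Pa a); rewrite /T enum_rankK_in.
exists #|P|, T; split=> [i j|X].
  have [<-|ij] := eqVneq i j; first exact: dimhom_simple_self.
  by apply: dimhom_simple_neq => // /T_inj/eqP; rewrite (negPf ij).
have [_ /(_ X)[r [U [sU sumU]]]] := ssC.
pose l a := sval (cid (T_all _ (sU a))).
exists r, l; apply: direct_sum_isomorphic sumU => a.
exact: svalP (cid (T_all _ (sU a))).
Qed.


End Schur.

(** * Tensor products of direct sums *)

Section TensorSums.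
Variables (k : fieldType) (C : tensorCat k).
Implicit Types X Y Z : C.

Lemma tensm0 X X' Y Y' (f : hom X X') : f \otm (0 : hom Y Y') = 0.
Proof.
exact: (@linear_0 _ _ _ (fun g : hom Y Y' => f \otm g) (@tensm_linearr k C _ _ _ _ f)).
Qed.

Lemma tensm_sumr X X' Y Y' (f : hom X X') (I : finType) (v : I -> hom Y Y') :
  f \otm (\sum_i v i) = \sum_i f \otm v i.
Proof.
elim/big_rec2: _ => [|i x y _ <-]; first exact: tensm0.
by have := @tensm_linearr k C _ _ _ _ f 1 (v i) y; rewrite !scale1r.
Qed.

Lemma tens_direct_sumr Z (I : finType) (S : I -> C) X :
  is_direct_sum S X -> is_direct_sum (fun a => Z \ot S a) (Z \ot X).
Proof.
move=> [i [p [pi pi0 ipE]]].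
exists (fun a => idm Z \otm i a), (fun a => idm Z \otm p a); split=> [a|a b ab|].
- by rewrite -tensm_cmpr pi tensm_id.
- by rewrite -tensm_cmpr pi0 // tensm0.
rewrite -tensm_id -ipE tensm_sumr; apply: eq_bigr => a _.
by rewrite tensm_cmpr.
Qed.

Lemma tens_isomorphicr Z X Y : isomorphic X Y -> isomorphic (Z \ot X) (Z \ot Y).
Proof.
move=> [f [g [gf fg]]]; exists (idm Z \otm f), (idm Z \otm g).
by rewrite -!tensm_cmpr gf fg !tensm_id.
Qed.

Lemma tens_unitl X : isomorphic (unitob \ot X) X.
Proof. by exists (lunit X), (lunitV X); rewrite lunitK lunitVK. Qed.

Lemma tens_unitr X : isomorphic (X \ot unitob) X.
Proof. by exists (runit X), (runitV X); rewrite runitK runitVK. Qed.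

Lemma tens_assoc X Y Z : isomorphic ((X \ot Y) \ot Z) (X \ot (Y \ot Z)).
Proof. by exists (assoc X Y Z), (assocV X Y Z); rewrite assocK assocVK. Qed.

End TensorSums.

Lemma tens_direct_suml (k : fieldType) (C : tensorCat k) (Z : C) (I : finType)
    (S : I -> C) X :
  is_direct_sum S X -> is_direct_sum (fun a => S a \ot Z) (X \ot Z).
Proof. exact: (@tens_direct_sumr k (rev_tensor C)). Qed.

Lemma tens_isomorphicl (k : fieldType) (C : tensorCat k) (Z X Y : C) :
  isomorphic X Y -> isomorphic (X \ot Z) (Y \ot Z).
Proof. exact: (@tens_isomorphicr k (rev_tensor C)). Qed.

(** * Positive powers of simple objects contain the unit *)

Section Fusion.
Variables (k : closedFieldType) (C : tensorCat k).
Hypotheses (k0 : [pchar k] =i pred0) (fusC : fusion_cat C).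
Implicit Types X Y Z A B U V : C.

Let fin : finite_dim_homs C := fc_findim fusC.
Let h X Y : nat := dimhom fin X Y.

Let reps : exists m (T : 'I_m -> C),
  (forall i j, dimhom fin (T i) (T j) = (i == j)) /\
  forall X, exists n (l : 'I_n -> 'I_m), is_direct_sum (fun a => T (l a)) X.
Proof.
have [ss _ fs _ _] := fusC; have [ab _] := ss.
exact: simple_representatives.
Qed.

Let m : nat := sval (cid reps).
Let T : 'I_m -> C := sval (cid (svalP (cid reps))).

Let hT i j : h (T i) (T j) = (i == j).
Proof. by have [] := svalP (cid (svalP (cid reps))). Qed.

Let decomposition X : exists n (l : 'I_n -> 'I_m),
  is_direct_sum (fun a => T (l a)) X.
Proof. by have [_] := svalP (cid (svalP (cid reps))). Qed.

(** Both sides count the pairs of isomorphic simple summands of X and of Y. *)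
Lemma dimhom_sym X Y : h X Y = h Y X.
Proof.
have [n [l sX]] := decomposition X; have [r [q sY]] := decomposition Y.
rewrite /h (dimhom_suml _ _ _ sX) // (dimhom_sumr _ _ _ sX) //.
apply: eq_bigr => a _; rewrite (dimhom_suml _ _ _ sY) // (dimhom_sumr _ _ _ sY) //.
by apply: eq_bigr => b _; rewrite [LHS]hT [RHS]hT eq_sym.
Qed.

Lemma dimhom_isor A X Y : isomorphic X Y -> h A X = h A Y.
Proof.
move=> [f [g [gf fg]]].
apply: (@dimhom_iso _ _ k0 _ _ _ _ _ (fun u => f \oc u) (fun u => g \oc u)).
- exact: cmp_linearr.
- by move=> u; rewrite cmpA gf cmp1m.
- by move=> u; rewrite cmpA fg cmp1m.
Qed.

Lemma dimhom_isol A X Y : isomorphic X Y -> h X A = h Y A.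
Proof. by move=> XY; rewrite !(dimhom_sym _ A); apply: dimhom_isor. Qed.

(** In the Grothendieck group an additive functor acts by the matrix of its
    values on simple objects; this turns composition into matrix product. *)
Lemma dimhom_additive (G : C -> C) A Y :
  (forall (I : finType) (S : I -> C) X,
     is_direct_sum S X -> is_direct_sum (fun a => G (S a)) (G X)) ->
  h A (G Y) = (\sum_j h A (G (T j)) * h (T j) Y)%N.
Proof.
move=> addG; have [n [l sY]] := decomposition Y.
rewrite {1}/h (dimhom_sumr _ _ _ (addG _ _ _ sY)) //.
under [RHS]eq_bigr do rewrite {2}/h (dimhom_sumr _ _ _ sY) // big_distrr /=.
rewrite exchange_big; apply: eq_bigr => a _.
rewrite (bigD1 (l a)) //= [dimhom _ (T _) (T _)]hT eqxx muln1 big1 ?addn0 // => j ja.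
by rewrite [dimhom _ (T _) (T _)]hT (negPf ja) muln0.
Qed.

Lemma dimhom_dualr X Y A B : left_dual X Y -> h (A \ot X) B = h A (B \ot Y).
Proof.
move/(left_dual_adjunction A B) => [f [g [lf fK gK]]].
exact: (@dimhom_iso _ _ k0 _ _ _ _ _ f g).
Qed.

Lemma dimhom_duall X Y A B : left_dual X Y -> h (Y \ot A) B = h A (X \ot B).
Proof.
move/(left_dual_adjunction_rev A B) => [f [g [lf fK gK]]].
exact: (@dimhom_iso _ _ k0 _ _ _ _ _ f g).
Qed.

Lemma dimhom_unit : h unitob unitob = 1%N.
Proof.
have [[ab _] _ _ _ s1] := fusC; exact: dimhom_simple_self.
Qed.

(** A sum of n simple objects has at least n independent endomorphisms. *)
Lemma dimhom1_isomorphic X : h X X = 1%N -> exists j, isomorphic X (T j).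
Proof.
move=> h1; have [n [l sX]] := decomposition X.
have: (n <= h X X)%N.
  rewrite /h (dimhom_suml _ _ _ sX) // -[n in (n <= _)%N]card_ord -sum1_card.
  apply: leq_sum => a _; rewrite (dimhom_sumr _ _ _ sX) // (bigD1 a) //=.
  by rewrite [dimhom _ _ _]hT eqxx.
rewrite h1; case: n l sX => [|[|//]] l sX _.
  by move: h1; rewrite /h (dimhom_suml _ _ _ sX) // big_ord0.
have [i [p [pi _ ip]]] := sX; exists (l ord0), (p ord0), (i ord0).
by rewrite -ip big_ord1 pi.
Qed.

Lemma retract_dimhom U X : h U U = 1%N -> h U X != 0%N -> retract U X.
Proof.
case/dimhom1_isomorphic=> j Uj; rewrite (dimhom_isol _ Uj) => hX.
apply: (retract_trans (isomorphic_retract Uj)).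
have [n [l sX]] := decomposition X.
have [a ja] : exists a, j = l a.
  apply: contrapT => /forallNP nja; case/eqP: hX.
  rewrite /h (dimhom_sumr _ _ _ sX) // big1 // => a _.
  by rewrite [LHS]hT; case: eqP => // /nja.
by have [i [p [pi _ _]]] := sX; rewrite ja; exists (i a), (p a).
Qed.

(** In particular, duals of simple objects are simple. *)
Lemma dimhom_left_dual U V : left_dual U V -> h U U = h V V.
Proof.
move=> dUV.
rewrite -(dimhom_isol _ (tens_unitl U)) (dimhom_dualr _ _ dUV).
by rewrite -(dimhom_duall _ _ dUV) (dimhom_isol _ (tens_unitr V)).
Qed.

(** V (x) U contains the unit, hence V (x) (U (x) Y) contains Y. *)
Lemma tens_nonzero U V Y : left_dual U V -> h V V = 1%N ->
  idm (U \ot Y) = 0 -> idm Y = 0.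
Proof.
move=> dUV hV UY0.
have [|i [p pi]] := @retract_dimhom unitob (V \ot U) dimhom_unit.
  rewrite dimhom_sym (dimhom_duall _ _ dUV) (dimhom_isor _ (tens_unitr U)).
  by rewrite (dimhom_left_dual dUV) hV.
have a0 : assoc V U Y = 0 by rewrite -[LHS]cmp1m -tensm_id UY0 tensm0 cmp0m.
rewrite -(lunitVK Y) -[lunit Y]cmpm1 -tensm_id -pi tensm_cmpl.
by rewrite -[i \otm _]cmp1m -(assocK V U Y) a0 cmpm0 cmp0m !(cmpm0, cmp0m).
Qed.

(** [trace_nonnilpotent] gives an n such that the unit occurs in U^(n+1), and
    Hom(1, U (x) U^n) = Hom(V, U^n) by duality. *)
Lemma dual_in_powers U V : left_dual U V -> h V V = 1%N ->
  exists n, h V (iter n (tens U) unitob) != 0%N.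
Proof.
move=> dUV hV.
have [i0 iso0] := dimhom1_isomorphic dimhom_unit.
(* s b is the dual of b; it describes the transpose of R b below. *)
have adj b : exists j, forall A B, h A (B \ot T b) = h (A \ot T j) B.
  have [_ [W dW]] := fc_rigid fusC (T b).
  have [|j Wj] := @dimhom1_isomorphic W.
    by rewrite (dimhom_left_dual dW) hT eqxx.
  exists j => A B; rewrite -(dimhom_dualr _ _ dW).
  exact/dimhom_isol/tens_isomorphicr.
pose s b := sval (cid (adj b)).
have sP b A B : h A (B \ot T b) = h (A \ot T (s b)) B := svalP (cid (adj b)) A B.
pose mult G := \matrix_(c < m, d < m) (h (T c) (G (T d)))%:R : 'M[rat]_m.
have multM (F G : C -> C) :
    (forall (I : finType) (S : I -> C) X,
      is_direct_sum S X -> is_direct_sum (fun a => F (S a)) (F X)) ->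
    mult (F \o G) = mult F *m mult G.
  move=> addF; apply/matrixP => c d; rewrite !mxE /= dimhom_additive // natr_sum.
  by apply: eq_bigr => j _; rewrite !mxE natrM.
have mult_iso (F G : C -> C) : (forall X, isomorphic (F X) (G X)) -> mult F = mult G.
  by move=> FG; apply/matrixP => c d; rewrite !mxE (dimhom_isor _ (FG _)).
pose R b := mult (tens^~ (T b)).
pose L := mult (tens U).
have Lpow n : L ^+ n = mult (iter n (tens U)).
  elim: n => [|n IHn].
    by apply/matrixP => c d; rewrite !mxE hT.
  rewrite exprS IHn -[_ * _]multM // => I S X; exact: tens_direct_sumr.
have [|b|b|n|n] := @trace_nonnilpotent _ m i0 R s L.
- move=> b; rewrite -colE; apply/matrixP => c z; rewrite !mxE ord1 eqxx andbT.
  congr (_%:R); rewrite -hT; apply: dimhom_isor.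
  apply: isomorphic_trans (tens_unitl _).
  exact/tens_isomorphicl/isomorphic_sym.
- by apply/matrixP => c d; rewrite !mxE sP dimhom_sym.
- rewrite -!multM => [|I S X|I S X]; first last.
  + exact: tens_direct_sumr.
  + exact: tens_direct_suml.
  by apply: mult_iso => X /=; apply/isomorphic_sym/tens_assoc.
- apply/eqP => Ln0.
  have col0 c : h (T c) (iter n (tens U) (T i0)) = 0%N.
    have := congr1 (fun M : 'M_m => M c i0) Ln0.
    by rewrite Lpow !mxE => /eqP; rewrite pnatr_eq0 => /eqP.
  have : idm (iter n (tens U) (T i0)) = 0.
    have [r [l [i [p [_ _ <-]]]]] := decomposition (iter n (tens U) (T i0)).
    rewrite big1 // => a _.
    suff -> : p a = 0 by rewrite cmpm0.
    by move: (p a); apply/(@dimhom_eq0 _ _ k0 fin); rewrite -[LHS]dimhom_sym.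
  elim: n {Ln0 col0} => [/= id0|n IHn /= /(tens_nonzero dUV hV)//].
  by have := hT i0 i0; rewrite eqxx [LHS](idm0_dim k0 fin (T i0) id0).
rewrite Lpow mxE pnatr_eq0 iterS -(dimhom_duall _ _ dUV) => hn.
exists n; apply: contra_neq hn => <-.
rewrite (dimhom_isol _ (tens_isomorphicr _ (isomorphic_sym iso0))).
rewrite (dimhom_isol _ (tens_unitr V)); apply: dimhom_isor.
elim: n => [|n IHn]; first exact: isomorphic_sym.
exact: tens_isomorphicr.
Qed.

(** Decompose Y into simple objects V and let U be the dual of V.  Then
    Hom(V, Y) = Hom(V (x) X, 1) = Hom(X, U) is nonzero, so U is a summand of X and
    lies in D; by [dual_in_powers] V is a summand of a power of U. *)
Lemma dual_in_subcat (D : C -> Prop) X Y :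
  fusion_subcat D -> left_dual X Y -> D X -> D Y.
Proof.
move=> [[Dsum D1 Dtens] Dsummand] dXY DX.
have Dretract A B : D B -> retract A B -> D A.
  move=> DB AB; have [[ab _] _ _ _ _] := fusC.
  exact: Dsummand DB (retract_summand ab AB) (isomorphic_refl A).
have [n [l sY]] := decomposition Y.
have Dl a : D (T (l a)).
  have [_ [U dU]] := fc_rigid fusC (T (l a)).
  have hTa : h (T (l a)) (T (l a)) = 1%N by rewrite hT eqxx.
  have hY : h (T (l a)) Y != 0%N.
    rewrite /h (dimhom_sumr _ _ _ sY) // (bigD1 a) //=.
    by rewrite [dimhom _ _ _]hT eqxx.
  have DU : D U.
    apply: Dretract DX _; apply: retract_dimhom.
      by rewrite (dimhom_left_dual dU).
    rewrite dimhom_sym (dimhom_isor _ (isomorphic_sym (tens_unitr U))).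
    rewrite -(dimhom_duall _ _ dU) (dimhom_dualr _ _ dXY).
    by rewrite (dimhom_isor _ (tens_unitl Y)).
  have [r hr] := dual_in_powers dU hTa.
  apply: Dretract (retract_dimhom hTa hr).
  by elim: r {hr} => [|r IHr] //=; apply: Dtens.
have [Z DZ sZ] := Dsum _ _ Dl.
apply: (Dretract _ _ DZ).
have [i [p [pi pi0 ip]]] := sY; have [j [q [qj qj0 jq]]] := sZ.
exists (\sum_a j a \oc p a), (\sum_a i a \oc q a).
rewrite cmp_suml -ip; apply: eq_bigr => a _.
rewrite cmp_sumr (bigD1 a) //= big1 ?addr0 => [|b ba].
  by rewrite !cmpA -[_ \oc q a \oc j a]cmpA qj cmpm1.
by rewrite !cmpA -[_ \oc q a \oc j b]cmpA qj0 ?cmpm0 ?cmp0m //; apply/eqP.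
Qed.

End Fusion.

(** * Rigidity *)

Section Reversal.
Variables (k : fieldType) (C : tensorCat k).

Lemma fusion_rev : fusion_cat C -> fusion_cat (rev_tensor C).
Proof.
move=> [ss rig fs fd s1]; split=> // X.
by have [[Y dY] [Z dZ]] := rig X; split;
  [exists Z | exists Y]; apply: left_dual_rev.
Qed.

Lemma fusion_subcat_rev (D : C -> Prop) :
  fusion_subcat D -> @fusion_subcat k (rev_tensor C) D.
Proof.
move=> [[Dsum D1 Dtens] Dsummand]; split=> //; split=> // X Y DX DY.
exact: Dtens.
Qed.

End Reversal.

Theorem corollaryF7 (k : closedFieldType) (char0 : [pchar k]%R =i pred0)
  (C : tensorCat k) (fusC : @fusion_cat k C)
  (D : C -> Prop) (fusD : @fusion_subcat k C D) :
  @rigid k (@full_tensor k C D (@fs_tensor k C D fusD)).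
Proof.
move=> [X DX]; have [[Y dXY] [Z dZX]] := fc_rigid fusC X; split.
  by exists (exist _ Y (dual_in_subcat char0 fusC fusD dXY DX)).
have DZ : D Z.
  exact: (@dual_in_subcat k (rev_tensor C) char0 (fusion_rev fusC) D X Z
    (fusion_subcat_rev fusD) (left_dual_rev dZX) DX).
by exists (exist _ Z DZ).
Qed.
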